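(* Let $\mathcal{X}$ be a set equipped with a total order $\le$, let $m \ge 2$, let $x_1 \le x_2 \le \cdots \le x_m$ be elements of $\mathcal{X}$, and let $w_1,\ldots,w_m > 0$. For $\boldsymbol{z} \in \mathbb{R}^m$ let $A(\boldsymbol{z})$ denote the unique minimizer of $\sum_{j=1}^m w_j (z_j - f_j)^2$ over all $\boldsymbol{f} \in \mathbb{R}^m$ such that $x_i \le x_j$ implies $f_i \ge f_j$. Let $\boldsymbol{z}, \tilde{\boldsymbol{z}} \in \mathbb{R}^m$ be such that $\boldsymbol{z} \le \tilde{\boldsymbol{z}}$ component-wise, and set $\boldsymbol{f} := A(\boldsymbol{z})$ and $\tilde{\boldsymbol{f}} := A(\tilde{\boldsymbol{z}})$. Then the following hold: (i) $\boldsymbol{f} \le \tilde{\boldsymbol{f}}$ component-wise. (ii) Let $k \in \{1,\ldots,m-1\}$ be such that $f_k > f_{k+1}$ and $\tilde{z}_j = z_j$ for all $j > k$. Then $\tilde{f}_j = f_j$ for all $j > k$. (iii) Let $k \in \{2,\ldots,m\}$ be such that $\tilde{f}_{k-1} > \tilde{f}_k$ and $\tilde{z}_j = z_j$ for all $j < k$. Then $\tilde{f}_j = f_j$ for all $j < k$. (iv) Let $k \in \{2,\ldots,m\}$ be such that $\tilde{z}_j = z_j$ for all $j < k$. Then $$\{j < k : \tilde{f}_j > \tilde{f}_{j+1}\} \subset \{j < k : f_j > f_{j+1}\}.$$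
   Context: The feasible set $\{\boldsymbol{f} \in \mathbb{R}^m : x_i \le x_j \text{ implies } f_i \ge f_j\}$ is non-empty, closed and convex, and the weighted sum of squares is strictly convex and coercive, so $A(\boldsymbol{z})$ exists and is unique. Ties $x_i = x_j$ with $i \ne j$ are allowed (they force $f_i = f_j$ for feasible $\boldsymbol{f}$). In (iv), indices $j$ range over $\{1,\ldots,k-1\}$. *)

(* Defs.v *)
From HB Require Import structures.
From mathcomp Require Import all_boot all_order all_algebra.
From mathcomp Require Import all_classical all_reals all_analysis.
From mathcomp Require Import lra ring.
Set Implicit Arguments.
Unset Strict Implicit.
Unset Printing Implicit Defensive.
Import Order.TTheory GRing.Theory Num.Theory.
Import numFieldNormedType.Exports.
Local Open Scope classical_set_scope.
Local Open Scope ring_scope.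

Definition antitonic_vectors (R : realType) (d : Order.disp_t)
    (X : orderType d) (m : nat) (x : 'I_m -> X) : set 'rV[R]_m :=
  [set f | forall i j : 'I_m, (x i <= x j)%O -> f 0 j <= f 0 i].

Definition weighted_sq_dist (R : realType) (m : nat) (w z f : 'rV[R]_m) : R :=
  \sum_(j < m) w 0 j * (z 0 j - f 0 j) ^+ 2.

Definition is_antitonic_fit (R : realType) (d : Order.disp_t)
    (X : orderType d) (m : nat) (x : 'I_m -> X) (w z f : 'rV[R]_m) : Prop :=
  antitonic_vectors x f /\
  forall g : 'rV[R]_m, antitonic_vectors x g ->
    weighted_sq_dist w z f <= weighted_sq_dist w z g.

(* The default value 0 is never used when all weights are positive: see
   [antitonic_fitP] and [antitonic_fit_unique] below. *)
Definition antitonic_fit (R : realType) (d : Order.disp_t)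
    (X : orderType d) (m : nat) (x : 'I_m -> X) (w z : 'rV[R]_m) : 'rV[R]_m :=
  xget 0 [set f | is_antitonic_fit x w z f].

Lemma antitonic_vectors_closed (R : realType) (d : Order.disp_t)
    (X : orderType d) (m : nat) (x : 'I_m -> X) :
  closed (antitonic_vectors x : set 'rV[R]_m).
Proof.
rewrite (_ : antitonic_vectors x = \bigcap_(p in [set p | (x p.1 <= x p.2)%O])
    [set f : 'rV[R]_m | f 0 p.2 <= f 0 p.1]); last first.
  apply/seteqP; split=> f /= H; first by move=> [i j] /= ij; exact: H.
  by move=> i j ij; exact: (H (i, j)).
apply: closed_bigI => -[i j] /= _.
rewrite (_ : mkset _ = (fun f : 'rV[R]_m => f 0 i - f 0 j) @^-1`
    [set r | 0 <= r]); last by apply/seteqP; split=> f /=; rewrite subr_ge0.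
apply: preimage_closed; last exact: closed_ge.
move=> f _; have c k : continuous (fun f : 'rV[R]_m => f 0 k).
  exact: (@coord_continuous R 1 m 0 k).
exact: (cvgB (c i f) (c j f)).
Qed.

Lemma weighted_sq_dist_continuous (R : realType) (m : nat) (w z : 'rV[R]_m) :
  continuous (weighted_sq_dist w z).
Proof.
have c k : continuous (fun f : 'rV[R]_m => f 0 k).
  exact: (@coord_continuous R 1 m 0 k).
have cF j : continuous (fun f : 'rV[R]_m => w 0 j * (z 0 j - f 0 j) ^+ 2).
  move=> f.
  have cj : (fun f : 'rV[R]_m => z 0 j - f 0 j) @ f --> z 0 j - f 0 j.
    exact: (cvgB (cvg_cst _) (c j f)).
  exact: (cvgM (cvg_cst _) (cvgM cj cj)).
have := @continuous_big R 'I_m +%R 0 xpredT (@add_continuous R) _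
  (index_enum 'I_m) _ (fun j _ => cF j).
exact.
Qed.

Lemma antitonic_fit_exists (R : realType) (d : Order.disp_t)
    (X : orderType d) (m : nat) (x : 'I_m -> X) (w z : 'rV[R]_m) :
  (forall j, 0 < w 0 j) -> exists f, is_antitonic_fit x w z f.
Proof.
move=> w0.
set S := weighted_sq_dist w z 0.
pose A : set 'rV[R]_m := antitonic_vectors x `&` [set f | weighted_sq_dist w z f <= S].
have zA : antitonic_vectors x (0 : 'rV[R]_m) by move=> i j _; rewrite !mxE.
have A0 : A 0 by split => //=.
have S0 : 0 <= S by apply: sumr_ge0 => j _; rewrite mulr_ge0 ?sqr_ge0 ?ltW.
have Acl : closed A.
  apply: closedI; first exact: antitonic_vectors_closed.
  apply: (@preimage_closed _ _ (weighted_sq_dist w z) [set r | r <= S]).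
    by move=> f _; exact: weighted_sq_dist_continuous.
  exact: closed_le.
have Abd : bounded_set A.
  pose M := \sum_(j < m) (`|z 0 j| + 1 + S / w 0 j).
  have M0 j : 0 <= `|z 0 j| + 1 + S / w 0 j.
    by rewrite !addr_ge0 // divr_ge0 // ltW.
  exists M; split; first exact: num_real.
  move=> N MN f [_ /= fS]; apply: le_trans (ltW MN).
  rewrite [leLHS]/Num.norm /= mx_normrE; apply/bigmax_leP; split.
    exact: sumr_ge0.
  move=> [i j] _ /=; rewrite ord1.
  rewrite /M (bigD1 j) //=; apply: ler_wpDr; first exact: sumr_ge0.
  have tS : (z 0 j - f 0 j) ^+ 2 <= S / w 0 j.
    rewrite ler_pdivlMr // mulrC; apply: le_trans fS.
    rewrite /weighted_sq_dist (bigD1 j) //= lerDl.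
    by apply: sumr_ge0 => k _; rewrite mulr_ge0 ?sqr_ge0 ?ltW.
  have -> : f 0 j = z 0 j - (z 0 j - f 0 j) by ring.
  apply: (le_trans (ler_normB _ _)); rewrite -addrA lerD2l.
  apply: le_trans (_ : 1 + (z 0 j - f 0 j) ^+ 2 <= _); last by rewrite lerD2l.
  by rewrite -[X in _ <= 1 + X]real_normK ?num_real //; nra.
have [||c + cmin] := @EVT_min_rV R m (weighted_sq_dist w z) A _
    (bounded_closed_compact Abd Acl).
- by exists 0.
- apply: continuous_subspaceT; exact: weighted_sq_dist_continuous.
rewrite inE => -[cA cS]; exists c; split => // g gA.
have [gS|gS] := leP (weighted_sq_dist w z g) S.
  by apply: cmin; rewrite inE; split.
exact: le_trans cS (ltW gS).
Qed.

Lemma antitonic_fitP (R : realType) (d : Order.disp_t)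
    (X : orderType d) (m : nat) (x : 'I_m -> X) (w z : 'rV[R]_m) :
  (forall j, 0 < w 0 j) -> is_antitonic_fit x w z (antitonic_fit x w z).
Proof.
by move=> w0; have [f fP] := antitonic_fit_exists x z w0; exact: xgetI fP.
Qed.

Lemma antitonic_fit_unique (R : realType) (d : Order.disp_t)
    (X : orderType d) (m : nat) (x : 'I_m -> X) (w z f : 'rV[R]_m) :
  (forall j, 0 < w 0 j) -> is_antitonic_fit x w z f ->
  f = antitonic_fit x w z.
Proof.
move=> w0 [fA fmin]; have [gA gmin] := antitonic_fitP x z w0.
set g := antitonic_fit x w z in gA gmin *.
pose h : 'rV[R]_m := \row_j ((f 0 j + g 0 j) / 2).
have hA : antitonic_vectors x h.
  by move=> i j ij; rewrite !mxE; have := fA _ _ ij; have := gA _ _ ij; lra.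
have hE : weighted_sq_dist w z h *+ 4 +
    \sum_(j < m) w 0 j * (f 0 j - g 0 j) ^+ 2 =
    weighted_sq_dist w z f *+ 2 + weighted_sq_dist w z g *+ 2.
  rewrite /weighted_sq_dist -!sumrMnl -!big_split /=.
  by apply: eq_bigr => j _; rewrite mxE; field.
have D0 : \sum_(j < m) w 0 j * (f 0 j - g 0 j) ^+ 2 <= 0.
  by have := fmin _ hA; have := gmin _ hA; move: hE; lra.
have Dge j : 0 <= w 0 j * (f 0 j - g 0 j) ^+ 2.
  by rewrite mulr_ge0 ?sqr_ge0 ?ltW.
have D : \sum_(j < m) w 0 j * (f 0 j - g 0 j) ^+ 2 == 0.
  by rewrite eq_le D0 sumr_ge0.
apply/rowP => j; apply/eqP; rewrite -subr_eq0 -sqrf_eq0.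
move: D; rewrite psumr_eq0 // => /allP /(_ j (mem_index_enum j)).
by rewrite mulf_eq0 gt_eqF.
Qed.

(* Main.v *)
(** Since [z <= zt], replacing the pair of fits by its pointwise minimum and
    maximum does not increase the total distance to [z] and [zt], so uniqueness
    of the fit gives (i). For (ii) and (iii), a strict drop of one fit [f]
    between the index block [T] and its complement leaves room to move [f] on
    [T] slightly towards the other fit [g], whereas (i) lets [g] be replaced
    by [f] on [T]. The data agree on [T], so strict convexity forces [f = g]
    there. (iv) follows from (iii) and (i). *)
Require Import Defs.
From mathcomp Require Import all_boot all_order all_algebra.
From mathcomp Require Import all_classical all_reals all_analysis.
From mathcomp Require Import lra ring.
Import Order.TTheory GRing.Theory Num.Theory.
Local Open Scope classical_set_scope.
Local Open Scope ring_scope.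

Lemma antitonic_fit_le {R : realType} {d : Order.disp_t} {X : orderType d}
    {m : nat} {x : 'I_m -> X} {w z zt : 'rV[R]_m} :
  (forall j, 0 < w 0 j) -> (forall j, z 0 j <= zt 0 j) ->
  forall j, antitonic_fit x w z 0 j <= antitonic_fit x w zt 0 j.
Proof.
move=> w0 zzt.
have [fA fmin] := antitonic_fitP x z w0.
have [gA gmin] := antitonic_fitP x zt w0.
set f := antitonic_fit x w z in fA fmin *.
set g := antitonic_fit x w zt in gA gmin *.
pose lo : 'rV[R]_m := \row_j Num.min (f 0 j) (g 0 j).
pose hi : 'rV[R]_m := \row_j Num.max (f 0 j) (g 0 j).
have loA : antitonic_vectors x lo.
  by move=> i j ij; rewrite !mxE le_min !ge_min fA // gA // orbT.
have hiA : antitonic_vectors x hi.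
  by move=> i j ij; rewrite !mxE ge_max !le_max fA // gA // orbT.
(* Only indices with [f j > g j] are exchanged; there the two squares change by
   [2 (z j - zt j) (f j - g j) <= 0]. *)
have exch : weighted_sq_dist w z lo + weighted_sq_dist w zt hi <=
    weighted_sq_dist w z f + weighted_sq_dist w zt g.
  rewrite /weighted_sq_dist -!big_split /=; apply: ler_sum => j _.
  rewrite !mxE -!mulrDr ler_pM2l //; have := zzt j.
  by case: (leP (f 0 j) (g 0 j)) => //; nra.
have lo_fit : is_antitonic_fit x w z lo.
  split=> // h hA; apply: le_trans (fmin h hA).
  by have := gmin _ hiA; lra.
move=> j; rewrite /f -(antitonic_fit_unique w0 lo_fit) mxE ge_min lexx.
by rewrite orbT.
Qed.

(** The order of the data enters only through feasibility of the spliced vector, so the lemma serves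
    (ii) and, with the two fits exchanged, (iii). *)
Lemma antitonic_fit_eq_on {R : realType} {d : Order.disp_t} {X : orderType d}
    {m : nat} {x : 'I_m -> X} {w z zt f g : 'rV[R]_m} (T : pred 'I_m) :
  (forall j, 0 < w 0 j) ->
  is_antitonic_fit x w z f -> is_antitonic_fit x w zt g ->
  (forall j, T j -> zt 0 j = z 0 j) ->
  (forall i j, (x i <= x j)%O -> T i != T j -> f 0 j < f 0 i) ->
  antitonic_vectors x (\row_j (if T j then f 0 j else g 0 j)) ->
  forall j, T j -> f 0 j = g 0 j.
Proof.
move=> w0 [fA fmin] [gA gmin] zT fT mixA.
pose h (e : R) : 'rV[R]_m :=
  \row_j (if T j then f 0 j + e * (g 0 j - f 0 j) else f 0 j).
have [e [e0 e1 hA]] : exists e, [/\ 0 < e, e < 1 & antitonic_vectors x (h e)].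
  suff small_e : \forall e \near 0^'+,
      [/\ 0 < e, e < 1 & antitonic_vectors x (h e)] by exact: filter_ex small_e.
  near=> e; have e0 : 0 < e by [].
  have e1 : e < 1 by near: e; exact: nbhs_right_lt.
  split => // i j ij.
  (* Across the boundary of [T] the gap [f i - f j] is positive and bounds [e]; there are finitely
     many pairs, so one [e] suits all. The summand 1 keeps the divisor positive when both
     differences vanish. *)
  have small : T i != T j -> e * (`|g 0 i - f 0 i| + `|g 0 j - f 0 j| + 1)
      < f 0 i - f 0 j.
    move=> Tij; rewrite -ltr_pdivlMr; last by rewrite ltr_wpDl ?addr_ge0.
    move: i j ij Tij; near: e.
    apply: filter_forall => i; apply: filter_forall => j.
    case: (boolP (x i <= x j)%O) => [ij|_]; last exact: nearW.
    case: (boolP (T i == T j)) => [_|Tij]; first exact: nearW.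
    have gap : 0 < (f 0 i - f 0 j) /
        (`|g 0 i - f 0 i| + `|g 0 j - f 0 j| + 1).
      by rewrite divr_gt0 ?subr_gt0 ?fT // ltr_wpDl ?addr_ge0.
    by apply: filterS (nbhs_right_lt gap) => e.
  rewrite !mxE; move: small (fA _ _ ij) (gA _ _ ij).
  have := ler_norm (g 0 j - f 0 j).
  have := ler_norm (- (g 0 i - f 0 i)); rewrite normrN.
  have := normr_ge0 (g 0 i - f 0 i); have := normr_ge0 (g 0 j - f 0 j).
  case: (T i); case: (T j) => //=.
  - by move=> _ _ _ _ _; nra.
  - by move=> ? ? ? ? /(_ isT); nra.
  - by move=> ? ? ? ? /(_ isT); nra.
set mix := \row_j _ in mixA.
pose S := \sum_(j < m) w 0 j * (if T j then (g 0 j - f 0 j) ^+ 2 else 0).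
(* On [T] this is the convexity defect of the square at [(1 - e) (z - f) + e (z - g)]; off [T] both
   sides vanish. Both differences on the left are nonnegative by minimality, hence [S <= 0]. *)
have SE : weighted_sq_dist w z (h e) - weighted_sq_dist w z f +
    e * (weighted_sq_dist w zt mix - weighted_sq_dist w zt g) =
    - (e * (1 - e)) * S.
  rewrite /weighted_sq_dist -!sumrB !mulr_sumr -big_split /=.
  apply: eq_bigr => j _; rewrite !mxE.
  by case: ifPn => [/zT ->|_]; ring.
have S_ge0 j : 0 <= w 0 j * (if T j then (g 0 j - f 0 j) ^+ 2 else 0).
  by apply: mulr_ge0; [exact: ltW | case: ifP => _ //; exact: sqr_ge0].
have S0 : S == 0.
  rewrite eq_le sumr_ge0 // andbT.
  have := fmin _ hA; have := gmin _ mixA; rewrite -subr_ge0 => mg hf.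
  have emg := mulr_ge0 (ltW e0) mg.
  have ee : 0 < e * (1 - e) by rewrite mulr_gt0 ?subr_gt0.
  by rewrite -(pmulr_rle0 _ ee); lra.
move=> j Tj; move: S0; rewrite psumr_eq0 // => /allP/(_ j (mem_index_enum j)).
by rewrite /= Tj mulf_eq0 gt_eqF //= sqrf_eq0 subr_eq0 => /eqP.
Unshelve. all: by end_near.
Qed.

(** Ties allow [x i <= x j] with [j < i], but not across a strict drop: [x q <= x i <= x j <= x p]
    would force [f p <= f q]. *)
Lemma antitonic_drop {R : realType} {d : Order.disp_t} {X : orderType d}
    {m : nat} {x : 'I_m -> X} {f : 'rV[R]_m} {p q : 'I_m} :
  (forall i j : 'I_m, (i <= j)%N -> (x i <= x j)%O) ->
  antitonic_vectors x f -> q = p.+1 :> nat -> f 0 q < f 0 p ->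
  forall i j : 'I_m, (x i <= x j)%O -> (p < i)%N != (p < j)%N ->
  [/\ (i <= p)%N, (p < j)%N & f 0 j < f 0 i].
Proof.
move=> xmono fA qE fqp i j ij.
case: (ltnP p i) => pi; case: (ltnP p j) => pj //= _.
- have xqp : (x q <= x p)%O.
    by rewrite (le_trans (xmono q i _)) ?qE// (le_trans ij) ?xmono.
  by have := fA _ _ xqp; rewrite leNgt fqp.
- split=> //; apply: le_lt_trans (lt_le_trans fqp _); apply: fA.
    by rewrite xmono ?qE.
  exact: xmono.
Qed.

Theorem corollary2p2 (R : realType) (d : Order.disp_t) (X : orderType d)
    (m : nat) (x : 'I_m -> X) (w z zt : 'rV[R]_m)
    (hm : (2 <= m)%N)
    (hx : forall i j : 'I_m, (i <= j)%N -> (x i <= x j)%O)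
    (hw : forall j, 0 < w 0 j)
    (hz : forall j, z 0 j <= zt 0 j) :
  let f := antitonic_fit x w z in
  let ft := antitonic_fit x w zt in
  [/\ (* (i) *)
      forall j, f 0 j <= ft 0 j,
      (* (ii) *)
      forall k : 'I_m, (k.+1 < m)%N -> f 0 (ordS k) < f 0 k ->
        (forall j : 'I_m, (k < j)%N -> zt 0 j = z 0 j) ->
        forall j : 'I_m, (k < j)%N -> ft 0 j = f 0 j,
      (* (iii) *)
      forall k : 'I_m, (0 < k)%N -> ft 0 k < ft 0 (ord_pred k) ->
        (forall j : 'I_m, (j < k)%N -> zt 0 j = z 0 j) ->
        forall j : 'I_m, (j < k)%N -> ft 0 j = f 0 j
    & (* (iv) *)
      forall k : 'I_m, (0 < k)%N ->
        (forall j : 'I_m, (j < k)%N -> zt 0 j = z 0 j) ->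
        [set j : 'I_m | (j < k)%N /\ ft 0 (ordS j) < ft 0 j] `<=`
        [set j : 'I_m | (j < k)%N /\ f 0 (ordS j) < f 0 j] ].
Proof.
move=> f ft.
have fP : is_antitonic_fit x w z f := antitonic_fitP x z hw.
have ftP : is_antitonic_fit x w zt ft := antitonic_fitP x zt hw.
have fft : forall j, f 0 j <= ft 0 j by exact: antitonic_fit_le.
have iii (k : 'I_m) : (0 < k)%N -> ft 0 k < ft 0 (ord_pred k) ->
    (forall j : 'I_m, (j < k)%N -> zt 0 j = z 0 j) ->
    forall j : 'I_m, (j < k)%N -> ft 0 j = f 0 j.
  move=> k0 drop zk j jk.
  (* [ord_pred] is cyclic; [0 < k] excludes the wrap-around. *)
  have kE : k = (ord_pred k).+1 :> nat.
    rewrite /= -[(k + m)%N]prednK ?addn_gt0 ?k0 //=.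
    by rewrite -(prednK k0) addSn /= modnDr modn_small ?prednK // ltnW.
  have gap := antitonic_drop hx ftP.1 kE drop.
  have TE (i : 'I_m) : (i < k)%N = ~~ (ord_pred k < i)%N.
    by rewrite -leqNgt kE ltnS.
  apply: (antitonic_fit_eq_on (fun i : 'I_m => (i < k)%N)
    hw ftP fP) jk => //=.
  - by move=> i /zk.
  - move=> a b ab; rewrite !TE (inj_eq negb_inj) => Tab.
    by have [] := gap _ _ ab Tab.
  - move=> a b ab; rewrite !mxE !TE.
    have := gap _ _ ab; have := fP.1 _ _ ab; have := ftP.1 _ _ ab.
    case: (ltnP (ord_pred k) a); case: (ltnP (ord_pred k) b) => //=.
      by move=> _ _ _ _ [].
    (* For [a < k <= b] the spliced vector satisfies [f b <= ft b <= ft a]. *)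
    by move=> _ _ ftab _ _; exact: le_trans (fft b) ftab.
split=> // [k km drop zk j kj|k k0 zk j /= [jk drop]].
- have kE : ordS k = k.+1 :> nat by rewrite /= modn_small.
  have gap := antitonic_drop hx fP.1 kE drop.
  symmetry; apply: (antitonic_fit_eq_on (fun i : 'I_m => (k < i)%N)
    hw fP ftP) kj => //=.
  - by move=> a b ab Tab; have [] := gap _ _ ab Tab.
  - move=> a b ab; rewrite !mxE.
    have := gap _ _ ab; have := fP.1 _ _ ab; have := ftP.1 _ _ ab.
    case: (ltnP k a); case: (ltnP k b) => //=.
      by move=> _ _ _ _ [].
    (* For [a <= k < b], now [f b <= f a <= ft a]. *)
    by move=> _ _ _ fab _; exact: le_trans fab (fft a).
- have jE : ordS j = j.+1 :> nat.
    by rewrite /= modn_small // (leq_ltn_trans jk).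
  (* By (iii) with the cut just after [j], the fits agree at [j], so
     [f (j+1) <= ft (j+1) < ft j = f j]. *)
  split=> //; have <- : ft 0 j = f 0 j.
    apply: (iii (ordS j)); rewrite ?jE ?ordSK //.
    by move=> i ij; apply: zk; exact: leq_trans ij jk.
  exact: le_lt_trans (fft _) drop.
Qed.
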